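(* Let $G$ be a finite, simple, undirected, connected graph without isolated vertices. Then $\chi_{CN}(G)\le \max\{3,\ {\sf dc}(G)+1\}$.
   Context: A CFCN coloring of a graph $G=(V,E)$ using $k$ colors is an assignment $C:V(G)\to\{1,\dots,k\}$ such that for every $v\in V(G)$ there exists $i\in\{1,\dots,k\}$ with $|N[v]\cap C^{-1}(i)|=1$, where $N[v]=N(v)\cup\{v\}$ is the closed neighborhood of $v$. $\chi_{CN}(G)$ is the smallest number of colors required for a CFCN coloring of $G$. The distance to cluster ${\sf dc}(G)$ is the size of the smallest set $X\subseteq V$ such that $G[V\setminus X]$ is a disjoint union of cliques. *)

(* Defs.v *)
From mathcomp Require Import all_boot.
Set Implicit Arguments.
Unset Strict Implicit.
Unset Printing Implicit Defensive.

(* A finite simple undirected graph is a symmetric and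
   irreflexive adjacency relation [e : rel T] on a vertex type [T : finType]. *)

Section Graph.
Variables (T : finType) (e : rel T).

Definition simple_graph : Prop := symmetric e /\ irreflexive e.

Definition connected_graph : Prop := forall x y : T, connect e x y.

Definition no_isolated_vertex : Prop := forall x : T, exists y : T, e x y.

Definition open_nbhd (v : T) : {set T} := [set u | e v u].

Definition closed_nbhd (v : T) : {set T} := v |: open_nbhd v.

Definition cfcn_coloring (k : nat) (C : {ffun T -> 'I_k}) : bool :=
  [forall v, exists i : 'I_k, #|closed_nbhd v :&: C @^-1: [set i]| == 1].

Definition cfcn_colorable (k : nat) : bool :=
  [exists C : {ffun T -> 'I_k}, cfcn_coloring C].

Lemma cfcn_colorable_ex : exists k, cfcn_colorable k.
Proof.
exists #|T|; apply/existsP; exists [ffun x => enum_rank x].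
apply/forallP=> v; apply/existsP; exists (enum_rank v).
suff -> : closed_nbhd v :&: [ffun x => enum_rank x] @^-1: [set enum_rank v]
          = [set v] by rewrite cards1.
apply/setP=> u; rewrite !inE ffunE (inj_eq enum_rank_inj).
by case: (u == v); rewrite ?andbF.
Qed.

Definition chi_CN : nat := ex_minn cfcn_colorable_ex.

Definition clique (B : {set T}) : bool :=
  [forall x in B, forall y in B, (x != y) ==> e x y].

(* The subgraph induced on [S] is a disjoint union of cliques: [S] splits into
   cliques with no edge between two different ones. *)
Definition cluster_on (S : {set T}) : bool :=
  [exists P : {set {set T}},
    [&& partition P S,
        [forall B in P, clique B] &
        [forall B1 in P, forall B2 in P, (B1 != B2) ==>
          [forall x in B1, forall y in B2, ~~ e x y]]]].

Definition cluster_deletion_set (X : {set T}) : bool := cluster_on (~: X).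

Lemma cluster_deletion_size_ex :
  exists d, [exists X : {set T}, cluster_deletion_set X && (#|X| == d)].
Proof.
exists #|[set: T]|; apply/existsP; exists setT; rewrite eqxx andbT.
rewrite /cluster_deletion_set setCT; apply/existsP; exists set0.
rewrite partition_set0 eqxx /=.
by apply/andP; split; apply/forallP=> B; rewrite inE.
Qed.

Definition dist_to_cluster : nat := ex_minn cluster_deletion_size_ex.

End Graph.

(* Main.v *)
(* Let X be a smallest cluster deletion set, of size d.  Give colour 1 to one
   vertex of every clique of G - X and colour 0 to the others: every vertex
   outside X sees 1 exactly once, as long as X avoids colour 1.  If X is
   independent, colour all of X with 2, so that each vertex of X is the only
   vertex of colour 2 it sees.  Otherwise X contains an edge ab; colour a with 0
   and the d - 1 other vertices of X with distinct colours from 2 to d, so that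
   each of these sees its own colour once and a sees the colour of b once. *)

Require Import Defs.
From mathcomp Require Import all_boot.

Section ClusterColoring.
Variables (T : finType) (e : rel T).

Lemma in_closed_nbhd (v u : T) : (u \in closed_nbhd e v) = (u == v) || e v u.
Proof. by rewrite !inE. Qed.

(** Colours are natural numbers here, so that a colouring can be built by cases; the bound on them
    enters only in [chi_CN_le]. *)
Definition sees_once (c : T -> nat) (v u : T) : Prop :=
  u \in closed_nbhd e v /\
  forall w, w \in closed_nbhd e v -> c w = c u -> w = u.

Lemma chi_CN_le (k : nat) (c : T -> nat) :
  (forall v, c v < k) -> (forall v, exists u, sees_once c v u) ->
  chi_CN e <= k.
Proof.
move=> ck cP; rewrite /chi_CN; case: ex_minnP => m _; apply.
apply/existsP; exists [ffun v => Ordinal (ck v)].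
apply/forallP => v; have [u [uv uP]] := cP v.
apply/existsP; exists (Ordinal (ck u)); apply/cards1P; exists u.
apply/setP => w; rewrite in_setI in_set1 [w \in _ @^-1: _]inE ffunE in_set1 -val_eqE /=.
apply/andP/eqP => [[wv /eqP cw]|->]; first exact: uP.
by rewrite uv eqxx.
Qed.

Lemma cluster_deletion_set_min :
  exists2 X : {set T}, cluster_deletion_set e X & #|X| = dist_to_cluster e.
Proof.
rewrite /dist_to_cluster; case: ex_minnP => d /existsP[X /andP[clX /eqP dX]] _.
by exists X.
Qed.

(** [R] is a transversal of the cliques. Within [S], the closed neighbourhood of [v] is exactly the
    clique of [v], which contains a single member of [R]. *)
Lemma cluster_transversal (S : {set T}) : cluster_on e S ->
  exists2 R : {set T}, R \subset S &
    forall v, v \in S -> exists u,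
      [/\ u \in R, u \in closed_nbhd e v &
          forall w, w \in R -> w \in closed_nbhd e v -> w = u].
Proof.
case/existsP => P /and3P[partP clP sepP].
have trP := transversalP partP; set R := transversal P S in trP.
exists R; first exact: transversal_sub trP.
have [/eqP covP tiP _] := and3P partP.
move=> v vS; have vB : v \in pblock P v by rewrite mem_pblock covP.
have BP : pblock P v \in P by rewrite pblock_mem ?covP.
have /set0Pn[u] : R :&: pblock P v != set0.
  rewrite -card_gt0.
  by have /and3P[_ _ /forall_inP/(_ _ BP)/eqP->] := trP.
case/setIP => uR uB; exists u; split=> //.
  rewrite in_closed_nbhd; case: eqVneq => //= uv.
  have /forall_inP/(_ _ vB)/forall_inP/(_ _ uB) := forall_inP clP _ BP.
  by rewrite eq_sym uv.
move=> w wR; rewrite in_closed_nbhd => wv.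
have wS : w \in S by apply: (subsetP (transversal_sub trP)).
have wB : w \in pblock P w by rewrite mem_pblock covP.
have B'P : pblock P w \in P by rewrite pblock_mem ?covP.
have uS : u \in S by apply: (subsetP (transversal_sub trP)).
(* Members of a transversal that share a block are equal, and [w] lies in the block of [v] because
   no edge joins two cliques. *)
apply: (pblock_inj trP) => //.
rewrite (def_pblock tiP BP uB).
case/predU1P: wv => [->//|evw]; apply/eqP; apply/negPn/negP => neqB.
have /forall_inP/(_ _ B'P) := forall_inP sepP _ BP.
rewrite eq_sym neqB /= => /forall_inP/(_ _ vB)/forall_inP/(_ _ wB).
by rewrite evw.
Qed.

(** Outside [X] only the colours 0 and 1 are used, 1 marking the transversal. Since [f] avoids 1 on
    [X], that mark stays unique; since [1 < f y], no vertex outside [X] repeats the colour of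
    [y]. *)
Lemma chi_CN_extend (k : nat) (X : {set T}) (f : T -> nat) :
    1 < k -> cluster_deletion_set e X ->
    (forall x, x \in X -> f x < k /\ f x != 1) ->
    (forall x, x \in X -> exists y, [/\ y \in X, y \in closed_nbhd e x, 1 < f y &
       forall z, z \in X -> z \in closed_nbhd e x -> f z = f y -> z = y]) ->
  chi_CN e <= k.
Proof.
move=> k1 /cluster_transversal[R RX RP] fk fP.
pose c v := if v \in X then f v else nat_of_bool (v \in R).
apply: (chi_CN_le k c) => v; rewrite /c.
  case: ifP => [/fk[]//|_]; exact: leq_ltn_trans (leq_b1 _) k1.
have [vX|vX] := boolP (v \in X).
  have [y [yX yv fy yP]] := fP v vX; exists y; split=> // w wv; rewrite yX.
  case: ifP => [wX|_ bf]; first exact: yP.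
  by move: fy; rewrite -bf ltnNge leq_b1.
have [|u [uR uv uP]] := RP v; first by rewrite inE.
have /negPf uX : u \notin X by rewrite -in_setC (subsetP RX).
exists u; split=> // w wv; rewrite uX uR.
case: ifP => [/fk[_ /eqP]//|_]; case wR: (w \in R) => // _; exact: uP.
Qed.

End ClusterColoring.

Theorem theorem17 (T : finType) (e : rel T) (hG : simple_graph e)
    (hconn : connected_graph e) (hiso : no_isolated_vertex e) :
  chi_CN e <= maxn 3 (dist_to_cluster e + 1).
Proof.
have [X clX <-] := cluster_deletion_set_min T e; have [_ irr] := hG.
have k3 : 2 < maxn 3 (#|X| + 1) by rewrite leq_max.
case: (boolP [exists a in X, exists b in X, e a b]) => [|indep]; last first.
  apply: (chi_CN_extend T e _ X (fun=> 2)) => //; first exact: ltnW.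
  move=> x xX; exists x; split=> //; first by rewrite in_closed_nbhd eqxx.
  move=> z zX; rewrite in_closed_nbhd => /predU1P[//|exz] _.
  case/negP: indep; apply/exists_inP; exists x => //.
  by apply/exists_inP; exists z.
case/exists_inP => a aX /exists_inP[b bX eab].
have neq_ba : b != a by apply: contraTneq eab => ->; rewrite irr.
pose s := enum (X :\ a).
have mem_s x : (x \in s) = (x != a) && (x \in X) by rewrite mem_enum !inE.
(* The shift by 2 leaves 0 to [a] and skips 1. On [X :\ a] the index is below [#|X| - 1], so the
   colours are at most [#|X|]. *)
pose f x := if x == a then 0 else (index x s).+2.
have f_inj : {in X &, injective f}.
  move=> x y xX yX; rewrite /f; case: eqVneq => [->|xa]; case: eqVneq => [->|ya] //.
  by case; apply: (index_inj a); rewrite mem_s ?xa ?ya.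
apply: (chi_CN_extend T e _ X f) => //; first exact: ltnW.
  move=> x xX; rewrite /f; case: eqVneq => [_|xa]; first by rewrite (ltn_trans _ k3).
  split=> //; rewrite leq_max; apply/orP; right.
  have : index x s < size s by rewrite index_mem mem_s xa.
  by rewrite -cardE addn1 (cardsD1 a X) aX add1n !ltnS.
move=> x xX; case: (eqVneq x a) => [->|xa].
(* The colour 0 of [a] may recur outside [X], so [a] relies on [b], whose colour exceeds 1. *)
- exists b; rewrite in_closed_nbhd eab orbT /f (negPf neq_ba); split=> // z zX _.
  by move=> fz; apply: f_inj => //; rewrite /f (negPf neq_ba).
- exists x; rewrite in_closed_nbhd eqxx; split=> //; first by rewrite /f (negPf xa).
  by move=> z zX _; apply: f_inj.
Qed.
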